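(* Let $L>0$ and $\gamma\ge 2$. Assume that $F:\mathbb{R}^d\to\mathbb{R}^d$ is monotone and $L$-Lipschitz, that $A:\mathbb{R}^d\rightrightarrows\mathbb{R}^d$ is maximally monotone, and that the solution set $S:=\{z: 0\in F(z)+A(z)\}$ is nonempty. Let $z_0\in\mathbb{R}^d$ and let $\{z_t\}_{t\ge 0}$ be generated by $$z_{t+1}=J_{\alpha_tA}\bigl((1-\beta_t)z_t+\beta_tz_0-\alpha_tF(z_t)\bigr),\qquad \alpha_t=\frac{1}{L\sqrt{t+\gamma}},\quad \beta_t=\frac{\gamma}{t+\gamma},\qquad t\ge 0,$$ and set $$c_{t+1}:=\frac{(1-\beta_t)z_t+\beta_tz_0-\alpha_tF(z_t)-z_{t+1}}{\alpha_t},\qquad t\ge 0.$$ Fix any $z^\star\in S$ and define $$H_0:=\lVert z_0-z^\star\rVert,\qquad D:=(\sqrt{12}+1)H_0,\qquad E:=\max\{\gamma\lVert z_1-z_0\rVert,\,12\gamma D\}.$$ Then for every $T\ge 1$, $$r^{\mathrm{tan}}_{F,A}(z_T)\le\lVert F(z_T)+c_T\rVert\le\frac{L(2E+\gamma D)}{\sqrt{T-1+\gamma}}.$$ In particular, $\lVert z_1-z_0\rVert\le D$, so one may take $E=12\gamma D$, and therefore for every $T\ge1$ $$r^{\mathrm{tan}}_{F,A}(z_T)\le\frac{25\,\gamma LD}{\sqrt{T-1+\gamma}}=O\left(\frac{1}{\sqrt{T}}\right).$$ Consequently, the same $O(1/\sqrt{T})$ bound holds for the natural residual, i.e. $r^{\mathrm{nat}}_{F,A}(z_T)\le\frac{25\,\gamma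 LD}{\sqrt{T-1+\gamma}}$ for every $T\ge1$.
   Context: $\mathbb{R}^d$ carries the Euclidean inner product $\langle\cdot,\cdot\rangle$ and norm $\lVert\cdot\rVert$. $F$ is monotone if $\langle F(z)-F(w),z-w\rangle\ge 0$ for all $z,w$, and $L$-Lipschitz if $\lVert F(z)-F(w)\rVert\le L\lVert z-w\rVert$ for all $z,w$. A set-valued operator $A$ is monotone if $\langle a-b,z-w\rangle\ge0$ whenever $a\in A(z)$, $b\in A(w)$; it is maximally monotone if it is monotone and its graph is not a strict subset of the graph of another monotone operator. For $\alpha>0$, the resolvent is $J_{\alpha A}:=(\mathrm{Id}+\alpha A)^{-1}$, which for maximally monotone $A$ is single-valued and defined on all of $\mathbb{R}^d$; $z=J_{\alpha A}(w)$ iff $(w-z)/\alpha\in A(z)$ (hence $c_{t+1}\in A(z_{t+1})$). Tangent residual: $r^{\mathrm{tan}}_{F,A}(z):=\inf_{c\in A(z)}\lVert F(z)+c\rVert$ (the infimum is attained when $A(z)\ne\emptyset$). Natural residual: $r^{\mathrm{nat}}_{F,A}(z):=\lVert z-J_A(z-F(z))\rVert$. *)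

(* Defs.v *)
From mathcomp Require Import all_boot all_order all_algebra.
From mathcomp Require Import all_classical all_reals all_analysis.
Set Implicit Arguments.
Unset Strict Implicit.
Unset Printing Implicit Defensive.
Import Order.TTheory GRing.Theory Num.Theory.
Import numFieldNormedType.Exports.
Local Open Scope classical_set_scope.
Local Open Scope ring_scope.

(* R^d is 'rV[R]_d.  The library norm `|x| on this type is the sup norm, so
   the Euclidean structure is defined here. *)
Definition dotv (R : realType) (d : nat) (u v : 'rV[R]_d) : R :=
  \sum_(i < d) u 0 i * v 0 i.

Definition enorm (R : realType) (d : nat) (u : 'rV[R]_d) : R :=
  Num.sqrt (dotv u u).

Definition monotone_map (R : realType) (d : nat)
    (F : 'rV[R]_d -> 'rV[R]_d) : Prop :=
  forall z w, 0 <= dotv (F z - F w) (z - w).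

Definition euclidean_lipschitz (R : realType) (d : nat) (L : R)
    (F : 'rV[R]_d -> 'rV[R]_d) : Prop :=
  forall z w, enorm (F z - F w) <= L * enorm (z - w).

(* A set-valued operator on R^d is a map A : 'rV[R]_d -> set 'rV[R]_d; its
   domain [set z | A z !=set0] may be a proper subset. *)
Definition op_graph (R : realType) (d : nat)
    (A : 'rV[R]_d -> set 'rV[R]_d) : set ('rV[R]_d * 'rV[R]_d) :=
  [set p | A p.1 p.2].

Definition monotone_op (R : realType) (d : nat)
    (A : 'rV[R]_d -> set 'rV[R]_d) : Prop :=
  forall z w a b, A z a -> A w b -> 0 <= dotv (a - b) (z - w).

Definition maximally_monotone (R : realType) (d : nat)
    (A : 'rV[R]_d -> set 'rV[R]_d) : Prop :=
  monotone_op A /\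
  ~ exists B : 'rV[R]_d -> set 'rV[R]_d,
      monotone_op B /\ proper (op_graph A) (op_graph B).

Definition op_inv (R : realType) (d : nat)
    (B : 'rV[R]_d -> set 'rV[R]_d) : 'rV[R]_d -> set 'rV[R]_d :=
  fun w => [set z | B z w].

Definition resolvent_op (R : realType) (d : nat) (alpha : R)
    (A : 'rV[R]_d -> set 'rV[R]_d) : 'rV[R]_d -> set 'rV[R]_d :=
  op_inv (fun z => [set z + alpha *: a | a in A z]).

(* The value of J_{alpha A} at w: the element of (Id + alpha A)^{-1}(w), with
   junk value 0 if that set is empty.  For alpha > 0 and A maximally monotone
   the set is always a singleton (Minty), so the default is never used. *)
Definition resolvent (R : realType) (d : nat) (alpha : R)
    (A : 'rV[R]_d -> set 'rV[R]_d) (w : 'rV[R]_d) : 'rV[R]_d :=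
  xget 0 (resolvent_op alpha A w).

Definition zeros_sum (R : realType) (d : nat) (F : 'rV[R]_d -> 'rV[R]_d)
    (A : 'rV[R]_d -> set 'rV[R]_d) : set 'rV[R]_d :=
  [set z | [set F z + a | a in A z] 0].

(* Extended-real valued, so that the infimum over an empty A z is +oo. *)
Definition tangent_residual (R : realType) (d : nat)
    (F : 'rV[R]_d -> 'rV[R]_d) (A : 'rV[R]_d -> set 'rV[R]_d)
    (z : 'rV[R]_d) : \bar R :=
  ereal_inf [set (enorm (F z + c))%:E | c in A z].

Definition natural_residual (R : realType) (d : nat)
    (F : 'rV[R]_d -> 'rV[R]_d) (A : 'rV[R]_d -> set 'rV[R]_d)
    (z : 'rV[R]_d) : R :=
  enorm (z - resolvent 1 A (z - F z)).

Definition stepsize (R : realType) (L gamma : R) (t : nat) : R :=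
  1 / (L * Num.sqrt (t%:R + gamma)).

Definition anchor_weight (R : realType) (gamma : R) (t : nat) : R :=
  gamma / (t%:R + gamma).

(* The point (1 - beta_t) z_t + beta_t z_0 - alpha_t F(z_t) at which the
   resolvent is evaluated; x stands for z_t. *)
Definition anchored_forward (R : realType) (d : nat) (L gamma : R)
    (F : 'rV[R]_d -> 'rV[R]_d) (z0 : 'rV[R]_d) (t : nat) (x : 'rV[R]_d) :
    'rV[R]_d :=
  (1 - anchor_weight gamma t) *: x + anchor_weight gamma t *: z0
  - stepsize L gamma t *: F x.

(* Main.v *)
(* Boundedness of the iterates follows by induction from the nonexpansiveness of
   the resolvent.  The rate of the increments comes from comparing two
   consecutive inclusions [c_t \in A(z_t)]: monotonicity of [A] gives
   [0 <= <c_{t+2} - c_{t+1}, z_{t+2} - z_{t+1}>], which bounds the new increment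
   by a contraction of the old one plus a drift of order [1 / (t + gamma)^2] of
   the anchoring term, and hence yields [|z_{t+1} - z_t| = O(1 / t)] by induction.
   The residual is then read off the definition of [c_{t+1}].

   That resolvents have full domain (Minty) reduces by maximality and compactness
   to showing that finitely many balls with diameters [y_i, w - alpha b_i], where
   [b_i \in A(y_i)], have a common point. *)
Require Import Defs.
From mathcomp Require Import all_boot all_order all_algebra.
From mathcomp Require Import all_classical all_reals all_analysis.
From mathcomp Require Import ring lra.
Set Implicit Arguments.
Unset Strict Implicit.
Unset Printing Implicit Defensive.
Import Order.TTheory GRing.Theory Num.Theory.
Import numFieldNormedType.Exports.
Local Open Scope classical_set_scope.
Local Open Scope ring_scope.

(** * Euclidean inner product and norm on row vectors *)

Section EuclideanRowVectors.
Variables (R : realType) (d : nat).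
Implicit Types (u v w : 'rV[R]_d) (a : R).

Lemma dotvC u v : dotv u v = dotv v u.
Proof. by apply: eq_bigr => i _; rewrite mulrC. Qed.

Lemma dotvDl u v w : dotv (u + v) w = dotv u w + dotv v w.
Proof. by rewrite -big_split; apply: eq_bigr => i _; rewrite mxE mulrDl. Qed.

Lemma dotvDr u v w : dotv w (u + v) = dotv w u + dotv w v.
Proof. by rewrite dotvC dotvDl !(dotvC w). Qed.

Lemma dotvZl a u v : dotv (a *: u) v = a * dotv u v.
Proof. by rewrite mulr_sumr; apply: eq_bigr => i _; rewrite mxE mulrA. Qed.

Lemma dotvZr a u v : dotv u (a *: v) = a * dotv u v.
Proof. by rewrite dotvC dotvZl dotvC. Qed.

Lemma dotvNl u v : dotv (- u) v = - dotv u v.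
Proof. by rewrite -scaleN1r dotvZl mulN1r. Qed.

Lemma dotvNr u v : dotv u (- v) = - dotv u v.
Proof. by rewrite dotvC dotvNl dotvC. Qed.

Definition dotvE := (dotvDl, dotvDr, dotvNl, dotvNr, dotvZl, dotvZr).

Lemma dotv_suml n (l : 'I_n -> R) (p : 'I_n -> 'rV[R]_d) v :
  dotv (\sum_i l i *: p i) v = \sum_i l i * dotv (p i) v.
Proof.
elim/big_ind2: _ => [|x1 x2 y1 y2 <- <-|i _]; last exact: dotvZl.
  by rewrite -(scale0r 0) dotvZl mul0r.
exact: dotvDl.
Qed.

Lemma dotv_ge0 u : 0 <= dotv u u.
Proof. by apply: sumr_ge0 => i _; rewrite -expr2 sqr_ge0. Qed.

Lemma dotv_eq0 u : dotv u u = 0 -> u = 0.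
Proof.
move=> /eqP; rewrite psumr_eq0 => [/allP u0|i _]; last first.
  by rewrite -expr2 sqr_ge0.
apply/rowP => i; rewrite mxE; apply/eqP.
by move: (u0 i); rewrite mem_index_enum mulf_eq0 orbb; exact.
Qed.

Lemma sqr_coord_le u i : u 0 i ^+ 2 <= dotv u u.
Proof.
rewrite /dotv (bigD1 i)//= expr2 lerDl.
by apply: sumr_ge0 => j _; rewrite -expr2 sqr_ge0.
Qed.

Lemma enorm_ge0 u : 0 <= enorm u.
Proof. exact: sqrtr_ge0. Qed.

Lemma sqr_enorm u : enorm u ^+ 2 = dotv u u.
Proof. by rewrite sqr_sqrtr// dotv_ge0. Qed.

Lemma enorm0 : enorm (0 : 'rV[R]_d) = 0.
Proof. by rewrite /enorm -(scale0r 0) dotvZl mul0r sqrtr0. Qed.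

Lemma enormN u : enorm (- u) = enorm u.
Proof. by rewrite /enorm dotvNl dotvNr opprK. Qed.

Lemma enormZ a u : 0 <= a -> enorm (a *: u) = a * enorm u.
Proof.
move=> a0; rewrite /enorm dotvZl dotvZr mulrA -expr2.
by rewrite sqrtrM ?sqr_ge0// sqrtr_sqr ger0_norm.
Qed.

Lemma dotv_le_enorm u v : dotv u v <= enorm u * enorm v.
Proof.
have [u0|u0] := eqVneq (enorm u) 0.
  have /dotv_eq0 -> : dotv u u = 0 by rewrite -sqr_enorm u0 expr0n.
  by rewrite enorm0 mul0r -(scale0r 0) dotvZl mul0r.
have [v0|v0] := eqVneq (enorm v) 0.
  have /dotv_eq0 -> : dotv v v = 0 by rewrite -sqr_enorm v0 expr0n.
  by rewrite enorm0 mulr0 -(scale0r 0) dotvZr mul0r.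
(* Cauchy-Schwarz for nonzero vectors: expand the square of [enorm v *: u - enorm u *: v] and cancel
   [enorm u * enorm v]. *)
have up : 0 < enorm u * enorm v by rewrite mulr_gt0// lt0r ?u0 ?v0 enorm_ge0.
rewrite -(ler_pM2l up) -subr_ge0.
have := dotv_ge0 (enorm v *: u - enorm u *: v).
rewrite !dotvE -!sqr_enorm (dotvC v u); nra.
Qed.

Lemma enormD u v : enorm (u + v) <= enorm u + enorm v.
Proof.
rewrite -(@ler_pXn2r _ 2)// ?nnegrE ?addr_ge0 ?enorm_ge0//.
rewrite sqr_enorm !dotvE -!sqr_enorm (dotvC v u).
have := dotv_le_enorm u v; lra.
Qed.

End EuclideanRowVectors.

(** * Continuity of sums and compactness of the simplex *)

Lemma continuous_sum (R : realType) (T : topologicalType) (I : Type)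
    (r : seq I) (f : I -> T -> R) :
  (forall i, continuous (f i)) -> continuous (fun x => \sum_(i <- r) f i x).
Proof.
move=> fc; elim: r => [|i r IH].
  by under eq_fun do rewrite big_nil; exact: cst_continuous.
under eq_fun do rewrite big_cons.
by move=> x; apply: continuousD; [exact: fc|exact: IH].
Qed.

Lemma continuous_dotv (R : realType) (d : nat) (T : topologicalType)
    (f g : T -> 'rV[R]_d) :
  (forall j, continuous (fun x => f x 0 j)) ->
  (forall j, continuous (fun x => g x 0 j)) ->
  continuous (fun x => dotv (f x) (g x)).
Proof.
move=> fc gc; apply: continuous_sum => j x.
by apply: continuousM; [exact: fc|exact: gc].
Qed.

Definition simplex (R : realType) n : set 'rV[R]_n :=
  [set l | (forall i, 0 <= l 0 i) /\ \sum_i l 0 i = 1].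

Arguments simplex : clear implicits.

Lemma compact_simplex (R : realType) n : compact (simplex R n).
Proof.
have cube : compact [set l : 'rV[R]_n | forall i, 0 <= l ord0 i <= 1].
  have /rV_compact : forall i : 'I_n, compact [set x : R | 0 <= x <= 1].
    move=> _; rewrite -set_itvcc; exact: segment_compact.
  exact.
apply: (subclosed_compact _ cube).
- rewrite (_ : simplex R n = [set l : 'rV[R]_n | forall i, 0 <= l 0 i]
      `&` [set l | \sum_i l 0 i = 1])//.
  apply: closedI.
    have -> : [set l : 'rV[R]_n | forall i, 0 <= l 0 i] =
       \bigcap_i [set l : 'rV[R]_n | 0 <= l 0 i].
      by apply/seteqP; split=> l /= h i; [move=> _; exact: h|exact: h].
    apply: closed_bigI => i _.
    have c : continuous (fun l : 'rV[R]_n => l 0 i) by exact: coord_continuous.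
    exact: (closed_comp (fun l _ => c l) (@closed_ge R 0)).
  have c : continuous (fun l : 'rV[R]_n => \sum_i l 0 i).
    by apply: continuous_sum => i; exact: coord_continuous.
  exact: (closed_comp (fun l _ => c l) (@closed_eq R 1)).
- move=> l [l0 l1] i; rewrite /= l0/= -l1 (bigD1 i)//= lerDl.
  by apply: sumr_ge0.
Qed.

(** * Finite intersections of balls with given diameters *)

Lemma quadratic_le_slope_le0 (R : realType) (g C : R) : 0 <= C ->
  (forall s, 0 <= s <= 1 -> s * g <= s ^+ 2 * C) -> g <= 0.
Proof.
move=> C0 H; rewrite leNgt; apply/negP => g0.
have Cg : 0 < C + g by lra.
(* For [g > 0] this single value of [s] contradicts the hypothesis: it would give [C + g <= C]. *)
have s0 : 0 < g / (C + g) by apply: divr_gt0.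
have := H (g / (C + g)).
rewrite (ltW s0) ler_pdivrMr// mul1r lerDr C0 => /(_ isT).
rewrite expr2 -mulrA ler_pM2l// -mulrAC ler_pdivlMr//; nra.
Qed.

Section FiniteIntersection.
Variables (R : realType) (d n : nat) (u y : 'I_n -> 'rV[R]_d).

(** The weighted covariance of [u] and [y] summed over pairs; it carries a pairwise sign condition
    over to the averages. *)
Lemma weighted_cross_sum (l : 'I_n -> R) : \sum_i l i = 1 ->
  \sum_i l i * \sum_j l j * dotv (u i - u j) (y i - y j) =
  2 * (\sum_i l i * dotv (u i) (y i)
       - dotv (\sum_i l i *: u i) (\sum_i l i *: y i)).
Proof.
move=> l1; set S := \sum_i _ * dotv (u i) _; set U := \sum_i _ *: u i.
set Y := \sum_i _ *: y i.
have inner i : \sum_j l j * dotv (u i - u j) (y i - y j) =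
    dotv (u i) (y i) - dotv (u i) Y - dotv U (y i) + S.
  rewrite (dotvC (u i) Y) !dotv_suml.
  rewrite -[dotv (u i) (y i)]mul1r -l1 mulr_suml -!sumrB -big_split/=.
  by apply: eq_bigr => j _; rewrite !dotvE (dotvC (u i) (y j)); ring.
under eq_bigr do rewrite inner !mulrDr !mulrN.
rewrite !big_split/= !sumrN -mulr_suml l1 mul1r.
have -> : \sum_i l i * dotv (u i) Y = dotv U Y by rewrite dotv_suml.
have -> : \sum_i l i * dotv U (y i) = dotv U Y.
  by rewrite (dotvC U) dotv_suml; apply: eq_bigr => i _; rewrite dotvC.
rewrite -/S; ring.
Qed.

Hypothesis uy : forall i j, dotv (u i - u j) (y i - y j) <= 0.

(* At a maximiser [l] over the simplex of [min_z sum_i l_i <z - u_i, z - y_i>],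
   first-order optimality says that the inner minimiser [z] satisfies
   [<z - u_k, z - y_k> <= max] for every [k], while monotonicity makes the
   maximum nonpositive. *)
Lemma monotone_balls_meet : exists z, forall i, 0 <= dotv (u i - z) (z - y i).
Proof.
case: (posnP n) => [n0|].
  by exists 0 => -[i i_lt]; exfalso; rewrite n0 in i_lt.
move=> n_gt0; pose i0 : 'I_n := Ordinal n_gt0.
pose p i : 'rV[R]_d := 2^-1 *: (u i + y i).
pose Z (l : 'rV[R]_n) := \sum_i l 0 i *: p i.
pose K (l : 'rV[R]_n) := \sum_i l 0 i * dotv (u i) (y i).
(* On the simplex, [\sum_i l_i <z - u_i, z - y_i> = |z|^2 - 2 <z, Z l> + K l]; its minimum over [z]
   is [psi l], attained at [Z l]. *)
pose psi l := K l - dotv (Z l) (Z l).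
have psic : continuous psi.
  move=> l; apply: continuousB.
    apply: continuous_sum => {l} i l.
    apply: (@continuousM _ _ (fun l : 'rV[R]_n => l 0 i) (cst _)).
      exact: coord_continuous.
    exact: cst_continuous.
  have Zc j : continuous (fun l => Z l 0 j).
    under eq_fun do rewrite summxE.
    apply: continuous_sum => {l} i l; under eq_fun do rewrite mxE.
    apply: (@continuousM _ _ (fun l : 'rV[R]_n => l 0 i) (cst _)).
      exact: coord_continuous.
    exact: cst_continuous.
  exact: continuous_dotv.
have ne : simplex R n !=set0.
  exists (delta_mx 0 i0); split=> [i|]; first by rewrite mxE ler0n.
  rewrite (bigD1 i0)//= mxE !eqxx big1 ?addr0// => i /negbTE ii0.
  by rewrite mxE ii0 andbF.
have [l] := compact_EVT_max ne (@compact_simplex R n)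
  (continuous_subspaceT psic).
rewrite inE => -[l0 l1] lmax; exists (Z l) => k.
(* [K l <= <U, Y>] by the covariance identity, and [<U, Y> <= |(U + Y) / 2|^2 = |Z l|^2]. *)
have psi_le0 : psi l <= 0.
  have := @weighted_cross_sum (l 0) l1.
  set U := \sum_i _ *: u i; set Y := \sum_i _ *: y i; rewrite -/(K l) => cross.
  have KUY : K l <= dotv U Y.
    suff : 2 * (K l - dotv U Y) <= 0 by lra.
    rewrite -cross; apply: sumr_le0 => i _; apply: mulr_ge0_le0 => //.
    by apply: sumr_le0 => j _; apply: mulr_ge0_le0.
  have ZE : Z l = 2^-1 *: (U + Y).
    rewrite /Z /U /Y -big_split/= scaler_sumr; apply: eq_bigr => i _.
    by rewrite /p -scalerDr !scalerA mulrC.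
  have := dotv_ge0 (U - Y); rewrite /psi ZE !dotvE (dotvC Y U); lra.
pose m s := (1 - s) *: l + s *: delta_mx 0 k.
(* Stated over any module: it serves the points [p] and, over [R^o], the numbers in [K] and the
   total mass. *)
have comb (V : lmodType R) (v : 'I_n -> V) s :
    \sum_i m s 0 i *: v i = (1 - s) *: \sum_i l 0 i *: v i + s *: v k.
  under eq_bigr do rewrite !mxE scalerDl -!scalerA.
  rewrite big_split/= -!scaler_sumr; congr (_ + s *: _).
  rewrite (bigD1 k)//= !eqxx scale1r big1 ?addr0// => i /negbTE ->.
  by rewrite ?andbF/= scale0r.
suff : dotv (Z l - u k) (Z l - y k) - psi l <= 0.
  by rewrite -(opprB (Z l) (u k)) dotvNl; lra.
(* With [g] the slope to be bounded, [psi (m s) - psi l = s g - s^2 |p k - Z l|^2], which is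
   nonpositive because [l] is a maximiser. *)
apply: (@quadratic_le_slope_le0 _ _ (dotv (p k - Z l) (p k - Z l))).
  exact: dotv_ge0.
move=> s /andP[s0 s1].
have ms : m s \in simplex R n.
  rewrite inE; split=> [i|].
    by rewrite !mxE addr_ge0// mulr_ge0// ?ler0n// subr_ge0.
  have := comb R^o (fun=> 1) s; under eq_bigr do rewrite /GRing.scale/= mulr1.
  move=> ->; under eq_bigr do rewrite /GRing.scale/= mulr1.
  by rewrite l1 /GRing.scale/= !mulr1 subrK.
have := lmax _ ms; rewrite /psi /K /Z (comb _ p s) -/(Z l).
rewrite (comb R^o (fun i => dotv (u i) (y i)) s) -[X in _ *: X]/(K l).
have pE : 2 *: p k = u k + y k.
  by rewrite scalerA mulfV ?scale1r// pnatr_eq0.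
have ZpE : 2 * dotv (Z l) (p k) = dotv (Z l) (u k) + dotv (Z l) (y k).
  by rewrite -dotvZr pE dotvDr.
move: (p k) (Z l) ZpE => pk zl ZpE.
rewrite !dotvE (dotvC pk zl) (dotvC (u k) zl) /GRing.scale/= -/(K l).
have -> : dotv zl (y k) = 2 * dotv zl pk - dotv zl (u k) by rewrite ZpE; ring.
lra.
Qed.

End FiniteIntersection.

(** By Thales, this is the closed ball about the midpoint [p] with radius [r], half the diameter, so
    it lies in a cube. *)
Lemma compact_diameter_ball (R : realType) (d : nat) (u y : 'rV[R]_d) :
  compact [set z | 0 <= dotv (u - z) (z - y)].
Proof.
pose p : 'rV[R]_d := 2^-1 *: (u + y); pose r := enorm (2^-1 *: (u - y)).
have cube : compact
    [set z : 'rV[R]_d | forall i, p 0 i - r <= z ord0 i <= p 0 i + r].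
  have /rV_compact : forall i : 'I_d,
      compact [set x : R | p 0 i - r <= x <= p 0 i + r].
    by move=> i; rewrite -set_itvcc; exact: segment_compact.
  exact.
apply: (subclosed_compact _ cube) => [|z /= zP i].
  have c : continuous (fun z : 'rV[R]_d => dotv (u - z) (z - y)).
    apply: continuous_dotv => j; under eq_fun do rewrite !mxE; move=> z.
      by apply: continuousB; [exact: cst_continuous|exact: coord_continuous].
    by apply: continuousB; [exact: coord_continuous|exact: cst_continuous].
  exact: (closed_comp (fun l _ => c l) (@closed_ge R 0)).
rewrite -ler_distl.
rewrite -(@ler_pXn2r _ 2)// ?nnegrE ?normr_ge0 ?enorm_ge0//.
rewrite real_normK ?num_real//.
have := sqr_coord_le (z - p) i; rewrite [(z - p) 0 i]mxE [(- p) 0 i]mxE.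
move=> /le_trans; apply.
rewrite sqr_enorm /p; move: zP; rewrite !dotvE.
by rewrite (dotvC u z) (dotvC y z) (dotvC y u); lra.
Qed.

(** * Maximal monotonicity, Minty's theorem and nonexpansiveness *)

Section Resolvent.
Variables (R : realType) (d : nat) (A : 'rV[R]_d -> set 'rV[R]_d).
Hypothesis A_max : maximally_monotone A.
Implicit Types (a w y z : 'rV[R]_d) (alpha : R).

(** Otherwise adjoining [(z, a)] to the graph would give a strictly larger monotone operator. *)
Lemma maximally_monotone_mem z a :
  (forall y b, A y b -> 0 <= dotv (a - b) (z - y)) -> A z a.
Proof.
case: A_max => A_mono A_maxl za; apply: contrapT => nAza; apply: A_maxl.
exists (fun y b => A y b \/ (y = z /\ b = a)); split.
  move=> y x b c [Ayb|[-> ->]] [Axc|[-> ->]]; [exact: A_mono| |exact: za|].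
    by rewrite -(opprB a) -(opprB z) dotvNl dotvNr opprK; exact: za.
  by rewrite !subrr dotv_ge0.
split=> [[y b] Ayb|sub]; first by left.
by apply: nAza; apply: (sub (z, a)); right.
Qed.

Lemma maximally_monotone_nonempty : exists y b, A y b.
Proof.
apply: contrapT => A0; apply: (A0); exists 0, 0.
by apply: maximally_monotone_mem => y b Ayb; case: A0; exists y, b.
Qed.

Lemma minty alpha w : 0 < alpha -> resolvent_op alpha A w !=set0.
Proof.
move=> alpha0; have [y0 [b0 Ay0]] := maximally_monotone_nonempty.
pose u b : 'rV[R]_d := w - alpha *: b.
pose ball (i : 'rV[R]_d * 'rV[R]_d) :=
  [set z | 0 <= dotv (u i.2 - z) (z - i.1)].
have := @compact_diameter_ball R d (u b0) y0.
rewrite compact_In0 -/(ball (y0, b0)).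
(* Cutting every ball by the compact [ball (y0, b0)] gives closed subsets of one compact set, so
   finite intersections decide. *)
move=> /(_ _ (op_graph A) (fun i => ball (y0, b0) `&` ball i)).
case.
- exists ball => // i _; apply: compact_closed; first exact: norm_hausdorff.
  exact: compact_diameter_ball.
(* The base pair heads the list, so that the common point also lies in [ball (y0, b0)]. *)
- move=> D' D'A; pose s := (y0, b0) :: finmap.enum_fset D'.
  have sA (i : 'I_(size s)) : A (nth (0, 0) s i).1 (nth (0, 0) s i).2.
    have : nth (0, 0) s i \in s by exact: mem_nth.
    by rewrite inE => /predU1P[->//|/D'A]; rewrite inE.
  have [i j|z zP] := @monotone_balls_meet R d (size s)
      (fun i => u (nth (0, 0) s i).2) (fun i => (nth (0, 0) s i).1).
    have := A_max.1 _ _ _ _ (sA i) (sA j).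
    set bi := (nth _ s i).2; set bj := (nth _ s j).2 => M.
    (* Passing from [b] to [u b] flips the sign, turning monotonicity of [A] into the condition of
       [monotone_balls_meet]. *)
    have -> : u bi - u bj = - alpha *: (bi - bj).
      by apply/rowP => k; rewrite !mxE; ring.
    by rewrite dotvZl mulNr oppr_le0 mulr_ge0// ltW.
  exists z => i /= iD'; split; first exact: (zP ord0).
  have i_lt : (index i s < size s)%N by rewrite index_mem inE iD' orbT.
  by have := zP (Ordinal i_lt); rewrite /= nth_index// inE iD' orbT.
- move=> z zP; exists z, (alpha^-1 *: (w - z)).
    apply: maximally_monotone_mem => y b Ayb.
    have [_] := zP (y, b) Ayb; rewrite /ball /=.
    (* Up to the factor [alpha], lying in the ball of [(y, b)] is the monotonicity inequality
       between [(y, b)] and the candidate pair. *)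
    have -> : u b - z = alpha *: (alpha^-1 *: (w - z) - b).
      by rewrite scalerBr scalerA mulfV ?gt_eqF// scale1r /u addrAC.
    by rewrite dotvZl pmulr_rge0.
  by rewrite scalerA mulfV ?gt_eqF// scale1r addrC subrK.
Qed.

Lemma resolvent_mem alpha w : 0 < alpha ->
  A (resolvent alpha A w) (alpha^-1 *: (w - resolvent alpha A w)).
Proof.
move=> alpha0; rewrite /resolvent; have [x xP] := minty w alpha0.
have [c Ac wE] : resolvent_op alpha A w (xget 0 (resolvent_op alpha A w)).
  exact: xgetI xP.
rewrite -[X in _ *: (X - _)]wE addrAC subrr add0r scalerA mulVf ?gt_eqF//.
by rewrite scale1r.
Qed.

(** Nonexpansiveness of the resolvent, read on graph points: the cross term of the squared
    right-hand side is nonnegative. *)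
Lemma monotone_op_dist alpha z y a b : 0 < alpha -> A z a -> A y b ->
  enorm (z - y) <= enorm ((z + alpha *: a) - (y + alpha *: b)).
Proof.
move=> alpha0 Aza Ayb; have := A_max.1 _ _ _ _ Aza Ayb => ab.
rewrite -(@ler_pXn2r _ 2)// ?nnegrE ?enorm_ge0// !sqr_enorm.
have -> : z + alpha *: a - (y + alpha *: b) = (z - y) + alpha *: (a - b).
  by apply/rowP => i; rewrite !mxE; ring.
move: ab (dotv_ge0 (a - b)); move: (a - b) (z - y) => v x.
rewrite !dotvE (dotvC x v); nra.
Qed.

(** [z] is the resolvent of [z + a], a point that differs from [z - F z] by [F z + a];
    nonexpansiveness concludes. *)
Lemma natural_residual_le (F : 'rV[R]_d -> 'rV[R]_d) z a :
  A z a -> natural_residual F A z <= enorm (F z + a).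
Proof.
move=> Aza; rewrite /natural_residual.
have := monotone_op_dist ltr01 Aza (resolvent_mem (z - F z) ltr01).
rewrite invr1 !scale1r => /le_trans; apply.
rewrite le_eqVlt; apply/orP; left; apply/eqP; congr enorm.
by apply/rowP => i; rewrite !mxE; ring.
Qed.

Lemma tangent_residual_le (F : 'rV[R]_d -> 'rV[R]_d) z a :
  A z a -> (tangent_residual F A z <= (enorm (F z + a))%:E)%E.
Proof. by move=> Aza; apply: ereal_inf_lbound; exists a. Qed.

End Resolvent.

(** * Step sizes, the anchored forward step and scalar estimates *)

Lemma stepsize_gt0 (R : realType) (L gamma : R) t :
  0 < L -> 2 <= gamma -> 0 < stepsize L gamma t.
Proof.
move=> L0 gamma2; have := ler0n R t => t0.
by rewrite /stepsize divr_gt0// mulr_gt0// sqrtr_gt0; lra.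
Qed.

(* [al * L = 1 / sqrt n <= 1 / sqrt 2] gives [al L |u| <= (5/2) h], and then the
   anchoring loses at most as much as it gains:
   [(1 - be) * 12 + be + 5 be + 6 be = 12]. *)
Lemma anchored_forward_dist (R : realType) (d : nat) (L gamma n h : R)
    (u v G : 'rV[R]_d) :
  let be := gamma / n in let al := 1 / (L * Num.sqrt n) in
  0 < L -> 2 <= gamma -> gamma <= n ->
  0 <= dotv G u -> enorm G <= L * enorm u ->
  enorm v = h -> enorm u ^+ 2 <= 12 * h ^+ 2 ->
  enorm ((1 - be) *: u + be *: v - al *: G) ^+ 2 <= 12 * h ^+ 2.
Proof.
move=> be al L0 gamma2 gamman Gu GL vh uh.
have n0 : 0 < n by lra.
have alL : al * L = (Num.sqrt n)^-1.
  by rewrite /al div1r invfM mulrAC mulVf ?gt_eqF// mul1r.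
have k2 : (al * L) ^+ 2 = n^-1 by rewrite alL exprVn sqr_sqrtr// ltW.
have al0 : 0 < al by rewrite /al divr_gt0// mulr_gt0// sqrtr_gt0.
have be0 : 0 < be by rewrite divr_gt0//; lra.
have be1 : be <= 1 by rewrite ler_pdivrMr// mul1r.
have k2be : 2 * (al * L) ^+ 2 <= be.
  by rewrite k2 /be ler_pM2r ?invr_gt0.
have h0 : 0 <= h by rewrite -vh enorm_ge0.
have G0 := enorm_ge0 G; have u0 := enorm_ge0 u.
have alG : al * enorm G <= al * L * enorm u by rewrite -mulrA ler_pM2l.
have alG0 : 0 <= al * enorm G by rewrite mulr_ge0// ltW.
have alG2 : (al * enorm G) ^+ 2 <= (al * L) ^+ 2 * (12 * h ^+ 2).
  apply: (@le_trans _ _ ((al * L * enorm u) ^+ 2)).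
    by rewrite ler_pXn2r// nnegrE (le_trans alG0).
  by rewrite exprMn ler_wpM2l// sqr_ge0.
have alGbe : (al * enorm G) ^+ 2 <= be * (6 * h ^+ 2).
  by apply: le_trans alG2 _; have := sqr_ge0 h; nra.
(* From [be <= 1] and [6 <= (5 / 2)^2]. *)
have alGh : al * enorm G <= 5 / 2 * h.
  rewrite -(@ler_pXn2r _ 2)// ?nnegrE//; last by rewrite mulr_ge0.
  by apply: le_trans alGbe _; have := sqr_ge0 h; nra.
have vG : - (al * dotv v G) <= 5 / 2 * h ^+ 2.
  have := dotv_le_enorm v (- G); rewrite dotvNr enormN vh => vG.
  apply: (@le_trans _ _ (h * (al * enorm G))); last by nra.
  by rewrite -mulrN mulrCA ler_pM2l.
have uv : 2 * dotv u v <= enorm u ^+ 2 + h ^+ 2.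
  have := dotv_ge0 (u - v); rewrite -vh !sqr_enorm !dotvE (dotvC v u); lra.
have GG : al ^+ 2 * dotv G G <= be * (6 * h ^+ 2).
  by rewrite -sqr_enorm -exprMn.
have h2 := sqr_ge0 h; have e1 : 0 <= 1 - be by lra.
have uvb : 2 * (be * (1 - be) * dotv u v) <=
    be * (1 - be) * (enorm u ^+ 2 + h ^+ 2).
  by rewrite mulrCA ler_wpM2l// mulr_ge0// ltW.
have vGb : - (be * (al * dotv v G)) <= be * (5 / 2 * h ^+ 2).
  by rewrite -mulrN; apply: ler_wpM2l vG; exact: ltW.
have uGb : 0 <= (1 - be) * (al * dotv G u) 
  by apply: mulr_ge0 => //; apply: mulr_ge0 => //; exact: ltW.
have uub : (1 - be) * enorm u ^+ 2 <= (1 - be) * (12 * h ^+ 2).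
  exact: ler_wpM2l e1 _ _ uh.
have vv : dotv v v = h ^+ 2 by rewrite -sqr_enorm vh.
rewrite sqr_enorm !dotvE (dotvC v u) (dotvC u G) (dotvC G v) vv -!(sqr_enorm u).
lra.
Qed.

(* The left-hand side is the squared factor by which the increment shrinks; the
   slack [1/24] pays for the anchor drift, since [gamma D = E / 12]. *)
Lemma contraction_factor (R : realType) (gamma m : R) :
  2 <= gamma -> gamma <= m ->
  m / (m + 1) * (1 - gamma / m) ^+ 2 + (m + 1)^-1 <=
    ((m - 24^-1) / (m + 1)) ^+ 2.
Proof.
move=> gamma2 gammam; have m0 : 0 < m by lra.
have -> : m / (m + 1) * (1 - gamma / m) ^+ 2 + (m + 1)^-1 =
   ((m + 1) * ((m - gamma) ^+ 2 + m)) / (m * (m + 1) ^+ 2).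
  by field; rewrite !gt_eqF//; lra.
have -> : ((m - 24^-1) / (m + 1)) ^+ 2 =
   m * (m - 24^-1) ^+ 2 / (m * (m + 1) ^+ 2).
  by field; rewrite !gt_eqF//; lra.
rewrite ler_pM2r ?invr_gt0 ?mulr_gt0 ?exprn_gt0//; try lra.
(* The worst case is [gamma = 2]; there the cubic terms cancel, leaving a quadratic inequality valid
   for [m >= 2]. *)
have sq : (m - gamma) ^+ 2 <= (m - 2) ^+ 2.
  by rewrite ler_pXn2r// ?nnegrE; lra.
apply: (@le_trans _ _ ((m + 1) * ((m - 2) ^+ 2 + m))).
  by rewrite ler_pM2l ?lerD2r//; lra.
nra.
Qed.

(** The mismatch of consecutive anchor weights after rescaling by the step size ratio: [gamma (1 /
    sqrt (m (m + 1)) - 1 / (m + 1))], of order [1 / m^2]. *)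
Lemma anchor_drift (R : realType) (gamma m : R) : 0 <= gamma -> 0 < m ->
  0 <= Num.sqrt m / Num.sqrt (m + 1) * (gamma / m) - gamma / (m + 1)
    <= gamma / (2 * m * (m + 1)).
Proof.
move=> gamma0 m0.
have sm0 : 0 < Num.sqrt m by rewrite sqrtr_gt0.
have sn0 : 0 < Num.sqrt (m + 1) by rewrite sqrtr_gt0; lra.
have sm2 : Num.sqrt m ^+ 2 = m by rewrite sqr_sqrtr// ltW.
have sn2 : Num.sqrt (m + 1) ^+ 2 = m + 1 by rewrite sqr_sqrtr//; lra.
have smn : Num.sqrt m <= Num.sqrt (m + 1) by rewrite ler_sqrt//; lra.
move: (Num.sqrt m) (Num.sqrt (m + 1)) sm0 sn0 sm2 sn2 smn.
move=> p q p0 q0 p2 q2 pq; have n0 : 0 < m + 1 by lra.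
have pq0 : 0 < p * q by rewrite mulr_gt0.
have -> : p / q * (gamma / m) = gamma * (p * q)^-1.
  by rewrite -p2; field; rewrite !gt_eqF.
rewrite -mulrBr mulr_ge0//=; last first.
  by rewrite subr_ge0 lef_pV2 ?posrE// -q2 expr2 ler_pM2r.
apply: ler_wpM2l => //; rewrite lerBlDr.
have -> : (2 * m * (m + 1))^-1 + (m + 1)^-1 = (2 * m + 1) / (2 * (p * q) ^+ 2).
  by rewrite exprMn p2 q2; field; rewrite !gt_eqF.
have -> : (p * q)^-1 = 2 * (p * q) / (2 * (p * q) ^+ 2).
  by field; rewrite !gt_eqF.
rewrite ler_pM2r ?invr_gt0 ?mulr_gt0 ?exprn_gt0//.
(* [2 p q <= p ^ 2 + q ^ 2 = 2 m + 1] *)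
have := sqr_ge0 (p - q); rewrite sqrrB p2 q2; lra.
Qed.

(** * Boundedness, increments and residual of the iteration *)

Section AnchoredForwardBackward.
Variables (R : realType) (d : nat) (L gamma : R).
Variables (F : 'rV[R]_d -> 'rV[R]_d) (A : 'rV[R]_d -> set 'rV[R]_d).
Variables (z c : nat -> 'rV[R]_d) (zstar : 'rV[R]_d).
Hypotheses (L_gt0 : 0 < L) (gamma_ge2 : 2 <= gamma).
Hypotheses (F_mono : monotone_map F) (F_lip : euclidean_lipschitz L F).
Hypothesis A_max : maximally_monotone A.
Hypothesis zE : forall t : nat, z t.+1 =
  resolvent (stepsize L gamma t) A (anchored_forward L gamma F (z 0%N) t (z t)).
Hypothesis cE : forall t : nat, c t.+1 =
  (stepsize L gamma t)^-1 *:
    (anchored_forward L gamma F (z 0%N) t (z t) - z t.+1).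
Hypothesis zstar_sol : zeros_sum F A zstar.

Let H0 := enorm (z 0%N - zstar).
Let D := (Num.sqrt 12 + 1) * H0.

Lemma iterate_graph t : A (z t.+1) (c t.+1).
Proof. by rewrite cE zE; apply: resolvent_mem => //; exact: stepsize_gt0. Qed.

Lemma iterate_step t : z t.+1 + stepsize L gamma t *: c t.+1 =
  anchored_forward L gamma F (z 0%N) t (z t).
Proof.
by rewrite cE scalerA mulfV ?gt_eqF ?stepsize_gt0// scale1r addrC subrK.
Qed.

Lemma index_ge t : gamma <= t%:R + gamma.
Proof. by rewrite lerDr ler0n. Qed.

(** [zstar] is fixed by the unanchored step, as [- F zstar] lies in [A zstar]; nonexpansiveness
    reduces the induction to [anchored_forward_dist]. *)
Lemma dist_solution_le t : enorm (z t - zstar) ^+ 2 <= 12 * H0 ^+ 2.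
Proof.
have Azs : A zstar (- F zstar).
  by case: zstar_sol => a Aa /eqP; rewrite addrC addr_eq0 => /eqP <-.
elim: t => [|t IH]; first by have := sqr_ge0 H0; rewrite -/H0; lra.
apply: le_trans (@anchored_forward_dist R d L gamma (t%:R + gamma) H0
  (z t - zstar) (z 0%N - zstar) (F (z t) - F zstar) _ _ _ _ _ _ _) => //.
- rewrite ler_pXn2r// ?nnegrE ?enorm_ge0//.
  have := monotone_op_dist A_max (stepsize_gt0 t L_gt0 gamma_ge2)
    (iterate_graph t) Azs.
  rewrite iterate_step /anchored_forward -/(anchor_weight gamma t).
  rewrite -/(stepsize L gamma t).
  move=> /le_trans; apply; rewrite le_eqVlt; apply/orP; left; apply/eqP.
  by congr enorm; apply/rowP => i; rewrite !mxE; ring.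
- exact: index_ge.
Qed.

Lemma dist_anchor_le t : enorm (z t - z 0%N) <= D.
Proof.
have H00 : 0 <= H0 by exact: enorm_ge0.
rewrite (_ : z t - z 0%N = (z t - zstar) - (z 0%N - zstar)); last first.
  by rewrite opprB addrA subrK.
apply: le_trans (enormD _ _) _; rewrite enormN /D mulrDl mul1r lerD2r.
rewrite -(@ler_pXn2r _ 2)// ?nnegrE ?enorm_ge0 ?mulr_ge0 ?sqrtr_ge0//.
by rewrite exprMn (@sqr_sqrtr _ 12) ?ler0n//; exact: dist_solution_le.
Qed.

Lemma anchor_radius_ge0 : 0 <= D.
Proof. by rewrite mulr_ge0 ?enorm_ge0 ?addr_ge0 ?sqrtr_ge0. Qed.

Lemma increment_recursion t (m : R := t%:R + gamma)
    (rho : R := Num.sqrt m / Num.sqrt (m + 1)) :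
  enorm (z t.+2 - z t.+1) <=
  enorm ((rho * (1 - gamma / m)) *: (z t.+1 - z t)
         - stepsize L gamma t.+1 *: (F (z t.+1) - F (z t)))
  + (rho * (gamma / m) - gamma / (m + 1)) * D.
Proof.
have g2 := gamma_ge2; have gm : gamma <= m by exact: index_ge.
have m0 : 0 < m by lra.
have al0 := stepsize_gt0 t L_gt0 gamma_ge2.
have al0' := stepsize_gt0 t.+1 L_gt0 gamma_ge2.
have mS : t.+1%:R + gamma = m + 1 by rewrite /m -natr1; ring.
(* [rho] is the ratio of consecutive step sizes; it puts both inclusions on the later scale. *)
have rhoE : rho * stepsize L gamma t = stepsize L gamma t.+1.
  rewrite /rho /stepsize mS -/m; field.
  by rewrite !gt_eqF// sqrtr_gt0//; lra.
have := A_max.1 _ _ _ _ (iterate_graph t.+1) (iterate_graph t).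
have /andP[drift0 _] := @anchor_drift R gamma m ltac:(lra) m0.
set w1 := _ - stepsize L gamma t.+1 *: _.
rewrite -/rho in drift0.
set kappa := rho * _ - _ in drift0 *.
(* Splitting [z_t - z_0] as [(z_{t+1} - z_0) - (z_{t+1} - z_t)] leaves only the small weight [kappa]
   on the distance to the anchor. *)
have key : stepsize L gamma t.+1 *: (c t.+2 - c t.+1) =
    w1 + kappa *: (z t.+1 - z 0%N) - (z t.+2 - z t.+1).
  have e1 := iterate_step t.+1; have e2 := iterate_step t.
  have -> : stepsize L gamma t.+1 *: (c t.+2 - c t.+1) =
    (z t.+2 + stepsize L gamma t.+1 *: c t.+2) - z t.+2
     - rho *: ((z t.+1 + stepsize L gamma t *: c t.+1) - z t.+1).
    by rewrite -rhoE; apply/rowP => i; rewrite !mxE; ring.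
  rewrite e1 e2 /anchored_forward /anchor_weight -/m mS /w1 /kappa -rhoE.
  by apply/rowP => i; rewrite !mxE; ring.
rewrite -(pmulr_rge0 _ al0') -dotvZl key dotvDl dotvNl subr_ge0 -sqr_enorm.
set dz := z t.+2 - _ => H.
apply: (@le_trans _ _ (enorm (w1 + kappa *: (z t.+1 - z 0%N)))).
  have [->|dz0] := eqVneq (enorm dz) 0; first exact: enorm_ge0.
  have dzp : 0 < enorm dz by rewrite lt0r dz0 enorm_ge0.
  by rewrite -(ler_pM2r dzp) -expr2; apply: le_trans H (dotv_le_enorm _ _).
apply: le_trans (enormD _ _) _; rewrite lerD2l enormZ//.
by apply: ler_wpM2l => //; exact: dist_anchor_le.
Qed.

(** In the square, monotonicity of [F] discards the cross term and the Lipschitz bound makes the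
    last term at most the squared increment over [m + 1]; [contraction_factor] does the rest. *)
Lemma forward_increment_le t (m : R := t%:R + gamma)
    (rho : R := Num.sqrt m / Num.sqrt (m + 1)) :
  enorm ((rho * (1 - gamma / m)) *: (z t.+1 - z t)
         - stepsize L gamma t.+1 *: (F (z t.+1) - F (z t))) <=
  (m - 24^-1) / (m + 1) * enorm (z t.+1 - z t).
Proof.
have g2 := gamma_ge2; have gm : gamma <= m by exact: index_ge.
have m0 : 0 < m by lra.
have mS : t.+1%:R + gamma = m + 1 by rewrite /m -natr1; ring.
have al0 := stepsize_gt0 t.+1 L_gt0 gamma_ge2.
have alL : (stepsize L gamma t.+1 * L) ^+ 2 = (m + 1)^-1.
  rewrite /stepsize mS div1r invfM mulrAC mulVf ?gt_eqF// mul1r exprVn.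
  rewrite sqr_sqrtr//.
  lra.
have rho2 : rho ^+ 2 = m / (m + 1).
  by rewrite expr_div_n !sqr_sqrtr//; lra.
have rho0 : 0 <= rho by rewrite divr_ge0 ?sqrtr_ge0.
have be1 : 0 <= 1 - gamma / m by rewrite subr_ge0 ler_pdivrMr// mul1r.
rewrite -(@ler_pXn2r _ 2)// ?nnegrE ?enorm_ge0//; last first.
  by rewrite mulr_ge0 ?enorm_ge0// divr_ge0//; lra.
have := contraction_factor gamma_ge2 gm.
move=> /(ler_wpM2r (sqr_ge0 (enorm (z t.+1 - z t)))).
rewrite -exprMn; apply: le_trans.
have := F_mono (z t.+1) (z t); have := F_lip (z t.+1) (z t).
move: (F _ - F _) (z t.+1 - z t) => G u GL Gu.
have alG : (stepsize L gamma t.+1 * enorm G) ^+ 2 <= (m + 1)^-1 * enorm u ^+ 2.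
  have a1 : stepsize L gamma t.+1 * enorm G <=
      stepsize L gamma t.+1 * L * enorm u.
    by rewrite -mulrA ler_pM2l.
  have a0 : 0 <= stepsize L gamma t.+1 * enorm G.
    by rewrite mulr_ge0 ?enorm_ge0// ltW.
  by rewrite -alL -exprMn ler_pXn2r// nnegrE (le_trans a0).
have cross : 0 <= rho * (1 - gamma / m) * (stepsize L gamma t.+1 * dotv G u).
  exact: mulr_ge0 (mulr_ge0 rho0 be1) (mulr_ge0 (ltW al0) Gu).
rewrite mulrDl -rho2 -exprMn.
move: alG cross; rewrite [in X in X -> _]exprMn.
rewrite [_ ^+ 2 * enorm u ^+ 2]mulrC !sqr_enorm.
rewrite !dotvE (dotvC u G); lra.
Qed.

Lemma increment_le t :
  enorm (z t.+1 - z t) <= 12 * gamma * D / (t%:R + gamma).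
Proof.
have D0 := anchor_radius_ge0; have gamma0 : 0 < gamma by have := gamma_ge2; lra.
elim: t => [|t IH].
  (* At [t = 0] the denominator is [gamma], so the claim is [12 * D]. *)
  rewrite add0r mulrAC mulfK ?gt_eqF//.
  by apply: le_trans (dist_anchor_le 1) _; lra.
have gm := index_ge t; set m := t%:R + gamma in IH gm; have g2 := gamma_ge2.
have m0 : 0 < m by lra.
have mS : t.+1%:R + gamma = m + 1 by rewrite /m -natr1; ring.
have /andP[_ drift] := @anchor_drift R gamma m ltac:(lra) m0.
apply: le_trans (increment_recursion t) _; rewrite -/m mS.
have q0 : 0 <= (m - 24^-1) / (m + 1) by rewrite divr_ge0//; lra.
have := le_trans (forward_increment_le t) (ler_wpM2l q0 IH); rewrite -/m => h1.
apply: le_trans (lerD h1 (ler_wpM2r D0 drift)) _.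
(* An exact balance: with [E = 12 gamma D], [(m - 1/24) E / (m (m + 1)) + E / (24 m (m + 1)) = E /
   (m + 1)]. *)
rewrite le_eqVlt; apply/orP; left; apply/eqP; field.
by rewrite !gt_eqF//; lra.
Qed.

Lemma residual_le t : enorm (F (z t.+1) + c t.+1) <=
  25 * gamma * L * D / Num.sqrt (t%:R + gamma).
Proof.
have D0 := anchor_radius_ge0; have inc := increment_le t; have gm := index_ge t.
have g2 := gamma_ge2; have gamma0 : 0 <= gamma by lra.
have al0 := stepsize_gt0 t L_gt0 gamma_ge2.
have -> : F (z t.+1) + c t.+1 =
   (F (z t.+1) - F (z t)) + (stepsize L gamma t)^-1 *:
   (- (z t.+1 - z t) + - (anchor_weight gamma t *: (z t - z 0%N))).
  apply: (@scalerI _ _ (stepsize L gamma t)); first by rewrite gt_eqF.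
  rewrite scalerDr -{1}[stepsize _ _ _ *: c _](addKr (z t.+1)) iterate_step.
  rewrite scalerDr scalerA mulfV ?gt_eqF// scale1r /anchored_forward.
  by apply/rowP => i; rewrite !mxE; ring.
apply: le_trans (enormD _ _) _; rewrite enormZ ?invr_ge0 ?(ltW al0)//.
have be0 : 0 <= anchor_weight gamma t by rewrite divr_ge0//; lra.
have step2 : enorm (- (z t.+1 - z t)
      + - (anchor_weight gamma t *: (z t - z 0%N))) <=
    12 * gamma * D / (t%:R + gamma) + anchor_weight gamma t * D.
  apply: le_trans (enormD _ _) _; rewrite !enormN enormZ//.
  by apply: lerD => //; apply: ler_wpM2l => //; exact: dist_anchor_le.
have step1 : enorm (F (z t.+1) - F (z t)) <=
    L * (12 * gamma * D / (t%:R + gamma)).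
  by apply: le_trans (F_lip _ _) _; rewrite ler_pM2l.
have ia0 : 0 <= (stepsize L gamma t)^-1 by rewrite invr_ge0 ltW.
apply: le_trans (lerD step1 (ler_wpM2l ia0 step2)) _.
rewrite /stepsize /anchor_weight div1r invrK.
have m0 : 0 < t%:R + gamma by lra.
have sm2 : Num.sqrt (t%:R + gamma) ^+ 2 = t%:R + gamma.
  by rewrite sqr_sqrtr// ltW.
have sm0 : 0 < Num.sqrt (t%:R + gamma) by rewrite sqrtr_gt0.
have sm1 : 1 <= Num.sqrt (t%:R + gamma).
  by rewrite -[leLHS]sqrtr1 ler_sqrt//; lra.
move: (Num.sqrt _) sm2 sm0 sm1 => s <- s0 s1.
(* [25 = 12 + 12 + 1]: change of [F], increment, anchor. The first part decays like [1 / s^2], and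
   [s >= 1] brings it to [1 / s]. *)
rewrite -subr_ge0.
have -> : 25 * gamma * L * D / s -
   (L * (12 * gamma * D / s ^+ 2) +
    L * s * (12 * gamma * D / s ^+ 2 + gamma / s ^+ 2 * D)) =
   12 * gamma * L * D * (s - 1) / s ^+ 2.
  by field; rewrite gt_eqF.
apply: divr_ge0; last exact: sqr_ge0.
apply: mulr_ge0; last by rewrite subr_ge0.
by apply: mulr_ge0 => //; apply: mulr_ge0; [exact: mulr_ge0|exact: ltW].
Qed.

End AnchoredForwardBackward.

(** * Asymptotic rate and conclusion *)

Lemma shifted_rsqrt_bigO (R : realType) (gamma C : R) : 1 <= gamma -> 0 <= C ->
  (fun T : nat => C / Num.sqrt (T%:R - 1 + gamma))
    =O_\oo (fun T : nat => 1 / Num.sqrt T%:R).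
Proof.
(* The constant must be positive while [C] may vanish, hence [C + 1]. *)
move=> gamma1 C0; apply/eqO_exP; exists (C + 1); first by lra.
exists 1%N => // T /= T1.
have T0 : 0 < T%:R :> R by rewrite ltr0n.
rewrite div1r !ger0_norm ?invr_ge0 ?divr_ge0 ?sqrtr_ge0//.
apply: ler_pM; rewrite ?invr_ge0 ?sqrtr_ge0 ?lerDl//.
by rewrite lef_pV2 ?posrE ?sqrtr_gt0 ?ler_sqrt//; lra.
Qed.

Theorem theorem2 (R : realType) (d : nat) (L gamma : R)
    (F : 'rV[R]_d -> 'rV[R]_d) (A : 'rV[R]_d -> set 'rV[R]_d)
    (z c : nat -> 'rV[R]_d) (zstar : 'rV[R]_d) :
  0 < L -> 2 <= gamma ->
  monotone_map F -> euclidean_lipschitz L F ->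
  maximally_monotone A ->
  zeros_sum F A !=set0 ->
  (forall t : nat, z t.+1 =
     resolvent (stepsize L gamma t) A
       (anchored_forward L gamma F (z 0%N) t (z t))) ->
  (forall t : nat, c t.+1 =
     (stepsize L gamma t)^-1 *:
       (anchored_forward L gamma F (z 0%N) t (z t) - z t.+1)) ->
  zeros_sum F A zstar ->
  let H0 := enorm (z 0%N - zstar) in
  let D := (Num.sqrt 12 + 1) * H0 in
  let E := Num.max (gamma * enorm (z 1%N - z 0%N)) (12 * gamma * D) in
  let bound := fun T : nat =>
    25 * gamma * L * D / Num.sqrt (T%:R - 1 + gamma) in
  [/\ forall T : nat, (1 <= T)%N ->
        (tangent_residual F A (z T) <= (enorm (F (z T) + c T))%:E)%E /\
        enorm (F (z T) + c T)
          <= L * (2 * E + gamma * D) / Num.sqrt (T%:R - 1 + gamma),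
      enorm (z 1%N - z 0%N) <= D /\ E = 12 * gamma * D,
      forall T : nat, (1 <= T)%N ->
        (tangent_residual F A (z T) <= (bound T)%:E)%E,
      bound =O_\oo (fun T : nat => 1 / Num.sqrt T%:R)
    & forall T : nat, (1 <= T)%N -> natural_residual F A (z T) <= bound T].
Proof.
move=> L0 gamma2 Fm Fl Am _ zE cE zs H0 D E bound.
have Dge0 : 0 <= D by exact: anchor_radius_ge0.
have gamma0 : 0 < gamma by lra.
have z1D : enorm (z 1%N - z 0%N) <= D.
  exact: (dist_anchor_le L0 gamma2 Fm Fl Am zE cE zs).
have EE : E = 12 * gamma * D.
  apply/max_idPr; rewrite -mulrA mulrCA ler_pM2l//.
  by apply: le_trans z1D _; lra.
(* [c 0] is unconstrained; [c T] comes from the step of index [T - 1], hence the shift in the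
   bounds. *)
have cA T : (1 <= T)%N -> A (z T) (c T).
  by case: T => // t _; exact: (iterate_graph L0 gamma2 Am zE cE).
have res T : (1 <= T)%N -> enorm (F (z T) + c T) <= bound T.
  case: T => // t _; rewrite /bound -(natr1 t) addrK.
  exact: (residual_le L0 gamma2 Fm Fl Am zE cE zs).
split=> //.
- move=> T T1; split; first exact: tangent_residual_le (cA T T1).
  have -> : L * (2 * E + gamma * D) = 25 * gamma * L * D by rewrite EE; ring.
  exact: res.
- move=> T T1; apply: le_trans (tangent_residual_le F (cA T T1)) _.
  by rewrite lee_fin res.
- apply: shifted_rsqrt_bigO; first by lra.
  apply: mulr_ge0 => //; apply: mulr_ge0; last exact: ltW.
  by apply: mulr_ge0; last exact: ltW.
- move=> T T1.
  exact: le_trans (natural_residual_le Am F (cA T T1)) (res T T1).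
Qed.
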